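(* Let $\mathcal{A}=\{\mathbf a_1,\dots,\mathbf a_n\}\subset\mathbb N^m$, let $A\in\mathcal M_{m\times n}(\mathbb N)$ be the matrix with columns $\mathbf a_1,\dots,\mathbf a_n$, let $\mathcal L(\mathcal A)=\operatorname{Ker}_{\mathbb Z}(A)\subset\mathbb Z^n$, and assume $\mathcal L(\mathcal A)\cap\mathbb N^n=\{\mathbf 0\}$. Then the universal Markov basis $\mathcal M(\mathcal A)$ of $\mathcal A$ consists of all nonzero vectors in $\mathcal L(\mathcal A)$ with no proper strongly semiconformal decomposition.
   Context: $\mathbb N$ contains $0$. For $\mathbf u\in\mathbb Z^n$, $\mathbf u^+,\mathbf u^-\in\mathbb N^n$ are the unique vectors with disjoint supports such that $\mathbf u=\mathbf u^+-\mathbf u^-$. For vectors, $\mathbf a\ge\mathbf b$ is the componentwise order and $\mathbf a>\mathbf b$ means $\mathbf a\ge\mathbf b$ and $\mathbf a\ne\mathbf b$. A Markov basis of $\mathcal A$ is a finite subset $\mathcal M\subset\mathcal L(\mathcal A)$ such that for all $\mathbf w,\mathbf u\in\mathbb N^n$ with $\mathbf w-\mathbf u\in\mathcal L(\mathcal A)$ there is a finite (possibly empty) sequence $\mathbf v_1,\dots,\mathbf v_s$ with $\mathbf v_i\in\mathcal M$ or $-\mathbf v_i\in\mathcal M$ for each $i$, such that $\mathbf w-\mathbf u=\sum_{i=1}^s\mathbf v_i$ and $\mathbf w-\sum_{i=1}^p\mathbf v_i\in\mathbb N^n$ for all $1\le p\le s$. It is minimal if no proper subset of it is a Markov basis of $\mathcal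 A$. The universal Markov basis $\mathcal M(\mathcal A)$ is the union of all minimal Markov bases of $\mathcal A$, where vectors that differ only by a sign are identified. Strongly semiconformal decomposition: for $\mathbf u,\mathbf u_1,\dots,\mathbf u_l\in\mathcal L(\mathcal A)$ with $l\ge 2$, $\mathbf u=_{ssc}\mathbf u_1+\cdots+\mathbf u_l$ is a strongly semiconformal decomposition of $\mathbf u$ if $\mathbf u=\mathbf u_1+\cdots+\mathbf u_l$, $\mathbf u^+>\mathbf u_1^+$, and $\mathbf u^+>\big(\sum_{j=1}^{i-1}\mathbf u_j\big)+\mathbf u_i^+$ for all $i=2,\dots,l$. It is proper if all $\mathbf u_1,\dots,\mathbf u_l$ are nonzero. *)

(* Defs.v *)
From HB Require Import structures.
From mathcomp Require Import all_boot all_order all_algebra finmap.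
Set Implicit Arguments.
Unset Strict Implicit.
Unset Printing Implicit Defensive.
Import Order.TTheory GRing.Theory Num.Theory.
Local Open Scope ring_scope.

(* Vectors of Z^n are columns 'cV[int]_n, with entries u i 0; vectors of N^n
   are the integer columns satisfying nonneg. *)

Definition nonneg n (u : 'cV[int]_n) : Prop := forall i, 0 <= u i 0.

Definition vge n (a b : 'cV[int]_n) : Prop := forall i, b i 0 <= a i 0.

(* Not strict in every coordinate: a >= b componentwise and a <> b. *)
Definition vgt n (a b : 'cV[int]_n) : Prop := vge a b /\ a <> b.

Definition pos_part n (u : 'cV[int]_n) : 'cV[int]_n :=
  \col_i Num.max (u i 0) 0.

Definition neg_part n (u : 'cV[int]_n) : 'cV[int]_n :=
  \col_i Num.max (- u i 0) 0.

(* u^+ and u^- are characterized as the only vectors of N^n with disjoint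
   supports whose difference is u. *)
Lemma pos_neg_partP n (u a b : 'cV[int]_n) :
  [/\ nonneg a, nonneg b, forall i, a i 0 = 0 \/ b i 0 = 0 & u = a - b] <->
  a = pos_part u /\ b = neg_part u.
Proof.
split=> [[a0 b0 ab ->]|[-> ->]].
  split; apply/colP=> i; rewrite !mxE; move: (a0 i) (b0 i) => ai bi;
    case: (ab i) => ->; rewrite ?subr0 ?sub0r ?opprK.
  - by rewrite max_r // oppr_le0.
  - by rewrite max_l.
  - by rewrite max_l.
  - by rewrite max_r // oppr_le0.
split=> [i|i|i|]; rewrite ?mxE ?le_max ?lexx ?orbT //.
  by case: (leP 0 (u i 0)) => ui; [right; rewrite max_r // oppr_le0|left].
apply/colP=> i; rewrite !mxE; case: (leP 0 (u i 0)) => ui.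
  by rewrite max_r ?subr0 // oppr_le0.
by rewrite max_l ?sub0r ?opprK // oppr_ge0 ltW.
Qed.

(* Ker_Z(A): the entries of A are natural numbers, cast to int for the
   product with an integer column. *)
Definition kerZ m n (A : 'M[nat]_(m, n)) (u : 'cV[int]_n) : Prop :=
  map_mx Posz A *m u = 0.

Definition markov_basis m n (A : 'M[nat]_(m, n)) (M : {fset 'cV[int]_n}) :
    Prop :=
  (forall v, v \in M -> kerZ A v) /\
  (forall w u : 'cV[int]_n, nonneg w -> nonneg u -> kerZ A (w - u) ->
     exists vs : seq 'cV[int]_n,
       [/\ forall v, v \in vs -> v \in M \/ - v \in M,
           w - u = \sum_(v <- vs) v &
           forall p : nat, (1 <= p <= size vs)%N ->
             nonneg (w - \sum_(v <- take p vs) v)]).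

Definition minimal_markov_basis m n (A : 'M[nat]_(m, n))
    (M : {fset 'cV[int]_n}) : Prop :=
  markov_basis A M /\
  (forall M' : {fset 'cV[int]_n}, (M' `<` M)%fset -> ~ markov_basis A M').

(* Union of all minimal Markov bases with v and -v identified: u belongs to it
   when one of its two representatives u, -u lies in a minimal Markov basis. *)
Definition universal_markov_basis m n (A : 'M[nat]_(m, n))
    (u : 'cV[int]_n) : Prop :=
  exists M : {fset 'cV[int]_n},
    minimal_markov_basis A M /\ (u \in M \/ - u \in M).

(* The summands u_1, ..., u_l are stored as us`_0, ..., us`_(l-1). *)
Definition ssc_decomposition m n (A : 'M[nat]_(m, n)) (u : 'cV[int]_n)
    (us : seq 'cV[int]_n) : Prop :=
  [/\ (2 <= size us)%N,
      kerZ A u /\ (forall v, v \in us -> kerZ A v),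
      u = \sum_(v <- us) v,
      vgt (pos_part u) (pos_part us`_0) &
      forall i : nat, (1 <= i < size us)%N ->
        vgt (pos_part u) (\sum_(0 <= j < i) us`_j + pos_part us`_i)].

Definition proper_ssc_decomposition m n (A : 'M[nat]_(m, n)) (u : 'cV[int]_n)
    (us : seq 'cV[int]_n) : Prop :=
  ssc_decomposition A u us /\ (forall v, v \in us -> v <> 0).

(* Main.v *)
Require Import Defs.
From HB Require Import structures.
From mathcomp Require Import all_boot all_order all_algebra finmap.
From Stdlib Require Import Setoid Classical.
From Stdlib Require Import Relation_Operators Operators_Properties.
From mathcomp Require Import zify.
Set Implicit Arguments.
Unset Strict Implicit.
Unset Printing Implicit Defensive.
Import Order.TTheory GRing.Theory Num.Theory.
Local Open Scope ring_scope.

(** Fix a fiber: the nonnegative vectors congruent to one another modulo the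
lattice L = Ker A. Call two points of it linked when they are joined by a chain
in which consecutive points have intersecting supports. The partial sums of a
proper strongly semiconformal decomposition of u trace such a chain from u^+ to
u^-: the point x reached before the summand v satisfies x > v^+ exactly when x
and x - v are nonnegative with intersecting supports. Hence a vector u of L is
nonzero without such a decomposition iff u^+ and u^- are not linked
([ssc_linked]), and the theorem says that the universal Markov basis consists of
the u for which u^+ and u^- lie in different link components of their fiber.

The assumption that L meets N^n only in 0 makes fibers antichains
([fiber_antichain]); so v^+ is the only point of its own fiber from which the
move v is possible, and v cannot be used between points x, y such that x + g
lies in the fiber of v^+ for some g > 0. Two consecutive points of a chain have
a common part g > 0, which can be removed before they are connected by a Markov
basis: linked points of the fiber of v^+ are therefore connected without v and
-v ([linked_walk]).

If u belongs to a minimal Markov basis M and u^+, u^- were linked, u could be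
replaced in every walk by moves other than u and -u, and M would not be minimal
([minimal_not_linked]).

Conversely let u^+ and u^- be unlinked. Finite Markov bases exist by Dickson's
lemma ([markov_basis_exists]); take S of least cardinality such that
S + {u} is one. If a proper subset T of it is a Markov basis, then u is not in
T, by the choice of S. A walk in T from u^+ to u^- leaves the component of u^+
for the last time by some move v. The two ends of this step are unlinked, so
they have disjoint supports and are v^+ and v^-. Now v^+ is connected to u^+
without v because they are linked, and v^- to u^- by the rest of the walk, which
never comes back to v^+; so v can be exchanged for u in T
([markov_basis_exchange]), against the minimality of S. *)

(** * Dickson's lemma and reflexive transitive closures *)

(* mxE leaves convertible but distinct copies of the column index 0; abstracting
   each entry merges these copies before the arithmetic. *)
Ltac entrywise := rewrite ?mxE;
  repeat match goal with |- context [@fun_of_matrix _ _ _ ?u ?i ?j] =>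
    move: (u i j) => ? end; lia.

(** Induction on the list of coordinates. If s dominates all of P outside the
coordinate i, it also dominates the x whose value at i is at least the largest
value occurring in s; the others are split into finitely many classes by their
value at i, and the induction hypothesis applies to each class. *)
Lemma dickson (I T : eqType) (f : T -> I -> nat) (r : seq I) (P : T -> Prop) :
  exists s : seq T, (forall x, x \in s -> P x) /\
    (forall x, P x ->
       exists2 y, y \in s & forall i, i \in r -> (f y i <= f x i)%N).
Proof.
elim: r P => [|i r IHr] P.
  case: (classic (exists x, P x)) => [[x Px]|noP].
    by exists [:: x]; split=> [y /[!inE]/eqP->|y _] //; exists x; rewrite ?inE.
  by exists [::]; split=> // x Px; case: noP; exists x.
have below N : exists s : seq T, (forall x, x \in s -> P x) /\
    (forall x, P x -> (f x i < N)%N ->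
       exists2 y, y \in s & forall j, j \in i :: r -> (f y j <= f x j)%N).
  elim: N => [|N [s [sP sdom]]]; first by exists [::].
  have [t [tP tdom]] := IHr (fun x => P x /\ f x i = N).
  exists (s ++ t); split=> [x|x Px].
    by rewrite mem_cat => /orP[/sP|/tP[]].
  rewrite ltnS leq_eqVlt => /orP[/eqP xN|/(sdom _ Px)[y ys ydom]]; last first.
    by exists y; rewrite // mem_cat ys.
  have [y yt ydom] := tdom x (conj Px xN).
  exists y => [|j]; first by rewrite mem_cat yt orbT.
  have [_ yN] := tP _ yt.
  by rewrite inE => /orP[/eqP->|/ydom //]; rewrite xN yN.
have [s [sP sdom]] := IHr P.
have [t [tP tdom]] := below (\max_(y <- s) f y i).
exists (s ++ t); split=> [x|x Px].
  by rewrite mem_cat => /orP[/sP|/tP].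
have [lt_x|ge_x] := ltnP (f x i) (\max_(y <- s) f y i).
  by have [y yt ydom] := tdom x Px lt_x; exists y; rewrite // mem_cat yt orbT.
have [y ys ydom] := sdom x Px.
exists y => [|j]; first by rewrite mem_cat ys.
rewrite inE => /orP[/eqP->|/ydom //].
by apply: leq_trans ge_x; apply: (@leq_bigmax_seq _ s xpredT (f^~ i)).
Qed.

(** The last part of the walk is recorded with all its vertices outside C, which
is what allows a later argument to exclude the move that leaves C from it. *)
Lemma last_exit (T : Type) (R : T -> T -> Prop) (C : T -> Prop) x z :
    clos_refl_trans T R x z -> ~ C z -> C x ->
  exists p q, [/\ C p, ~ C q, R p q &
    clos_refl_trans T (fun a b => [/\ R a b, ~ C a & ~ C b]) q z].
Proof.
move=> /clos_rt_rt1n_iff walk_xz nCz Cx.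
suff [//|[_ /(_ Cx)//]] : (exists p q, [/\ C p, ~ C q, R p q &
    clos_refl_trans T (fun a b => [/\ R a b, ~ C a & ~ C b]) q z]) \/
    (clos_refl_trans T (fun a b => [/\ R a b, ~ C a & ~ C b]) x z /\ ~ C x).
elim: walk_xz nCz {Cx} => [{}x|{}x y {}z Rxy _ IH] nCz.
  by right; split=> //; apply: rt_refl.
have [exit|[avoid nCy]] := IH nCz; first by left.
have [Cx|nCx] := classic (C x); first by left; exists x, y.
by right; split=> //; apply: rt_trans avoid; apply: rt_step; split.
Qed.

Lemma rt_sym (T : Type) (R : T -> T -> Prop) x y :
    (forall a b, R a b -> R b a) ->
  clos_refl_trans T R x y -> clos_refl_trans T R y x.
Proof.
move=> symR; elim=> [a b /symR|a|a b c _ ba _ cb].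
- exact: rt_step.
- exact: rt_refl.
- exact: rt_trans cb ba.
Qed.

Lemma rt_sub (T : Type) (R R' : T -> T -> Prop) x y :
    (forall a b, R a b -> clos_refl_trans T R' a b) ->
  clos_refl_trans T R x y -> clos_refl_trans T R' x y.
Proof.
move=> subR; elim=> [a b /subR //|a|a b c _ ab _ bc].
- exact: rt_refl.
- exact: rt_trans ab bc.
Qed.

(** * Walks in the graph of a set of moves *)

Section Vectors.
Variable n : nat.
Implicit Types u v w x y g : 'cV[int]_n.

Lemma pos_partN u : pos_part (- u) = neg_part u.
Proof. by apply/colP=> i; rewrite !mxE. Qed.

Lemma neg_partN u : neg_part (- u) = pos_part u.
Proof. by rewrite -pos_partN opprK. Qed.

Lemma pos_part_nonneg u : nonneg (pos_part u).
Proof. by move=> i; entrywise. Qed.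

Lemma neg_part_nonneg u : nonneg (neg_part u).
Proof. by move=> i; entrywise. Qed.

Lemma pos_partB u : pos_part u - neg_part u = u.
Proof. by apply/colP=> i; entrywise. Qed.

Lemma pos_part_vge x y : nonneg x -> nonneg y -> nonneg (x - pos_part (x - y)).
Proof. by move=> x0 y0 i; move: (x0 i) (y0 i); entrywise. Qed.

Lemma vgtP x y : vgt x y <-> nonneg (x - y) /\ exists i, y i 0 < x i 0.
Proof.
split=> [[xy neq]|[xy [i yxi]]]; last first.
  split=> [j|eqxy]; first by move: (xy j); entrywise.
  by move: yxi; rewrite eqxy ltxx.
split=> [i|]; first by move: (xy i); entrywise.
apply: NNPP => nex; apply: neq; apply/colP=> i.
apply/eqP; rewrite eq_le (xy i) andbT leNgt; apply/negP=> lt_i.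
by apply: nex; exists i.
Qed.

Definition step (M : {fset 'cV[int]_n}) x y : Prop :=
  [/\ nonneg x, nonneg y & x - y \in M \/ y - x \in M].

Definition walk M := clos_refl_trans _ (step M).

Lemma step_sym M x y : step M x y -> step M y x.
Proof. by case=> x0 y0 xy; split=> //; case: xy; [right|left]. Qed.

Lemma walk_sym M x y : walk M x y -> walk M y x.
Proof. by apply: rt_sym; apply: step_sym. Qed.

Lemma fproper_remove M v :
  v \in M \/ - v \in M -> (M `\` [fset v; - v] `<` M)%fset.
Proof.
move=> vM; rewrite fproperE fsubsetDl; apply/negP=> /fsubsetP sub.
by case: vM => /sub; rewrite in_fsetD in_fset2 eqxx ?orbT.
Qed.

Lemma step_avoid M v x y :
    step M x y -> x - y <> v -> y - x <> v ->
  step (M `\` [fset v; - v])%fset x y.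
Proof.
move=> [x0 y0 xyM] /eqP xyv /eqP yxv; split=> //.
have eqNN w : (- w == - v) = (w == v) by rewrite eqr_opp.
rewrite !in_fsetD !in_fset2 (negPf xyv) (negPf yxv).
rewrite -[x - y]opprB eqNN (negPf yxv) -[y - x]opprB eqNN (negPf xyv).
by rewrite !opprB.
Qed.

Lemma walkD M g x y : nonneg g -> walk M x y -> walk M (x + g) (y + g).
Proof.
move=> g0; elim=> [a b [a0 b0 ab]|a|a b c _ ab _ bc].
- apply: rt_step; split=> [i|i|].
  + by rewrite mxE addr_ge0.
  + by rewrite mxE addr_ge0.
  + have subD c d : c + g - (d + g) = c - d by apply/colP=> i; entrywise.
    by rewrite !subD.
- exact: rt_refl.
- exact: rt_trans ab bc.
Qed.

Lemma move_walk (M : {fset 'cV[int]_n}) u :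
  u \in M \/ - u \in M -> walk M (pos_part u) (neg_part u).
Proof.
move=> uM; apply: rt_step; split.
- exact: pos_part_nonneg.
- exact: neg_part_nonneg.
- by rewrite -[neg_part u - _]opprB pos_partB.
Qed.

(** A step by v from x is the step from v^+ to v^- translated by x - v^+, which
is nonnegative; only the pairs v^+, v^- have to be connected by M'. *)
Lemma walk_moves M M' x y :
    (forall v, v \in M -> walk M' (pos_part v) (neg_part v)) ->
  walk M x y -> walk M' x y.
Proof.
move=> MM'; apply: rt_sub => a b.
have main c d : nonneg c -> nonneg d -> c - d \in M -> walk M' c d.
  move=> c0 d0 /MM' /(walkD (pos_part_vge c0 d0)).
  suff <- : d = neg_part (c - d) + (c - pos_part (c - d)).
    by rewrite addrC subrK.
  by apply/colP=> i; entrywise.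
by case=> a0 b0 [ab|/(main _ _ b0 a0)/walk_sym]; first exact: main.
Qed.

(** The difference x - (x - y)^+ is the componentwise minimum of x and y. *)
Lemma sharesP x y : nonneg x -> nonneg y ->
  (exists i, 0 < x i 0 /\ 0 < y i 0) <-> vgt x (pos_part (x - y)).
Proof.
move=> x0 y0; rewrite vgtP; split=> [[i [xi yi]]|[_ [i xyi]]].
  split; first exact: pos_part_vge.
  by exists i; move: xi yi; entrywise.
by exists i; move: xyi (x0 i) (y0 i); entrywise.
Qed.

(** The conditions of a strongly semiconformal decomposition with u^+ replaced
by an arbitrary starting point, so that they can be followed one summand at a
time. *)
Fixpoint walk_down x (us : seq 'cV[int]_n) : Prop :=
  if us is v :: vs then vgt x (pos_part v) /\ walk_down (x - v) vs else True.

Lemma walk_downP x us :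
  walk_down x us <-> forall i, (i < size us)%N ->
    vgt x (\sum_(0 <= j < i) us`_j + pos_part us`_i).
Proof.
have vgtB (a b c : 'cV[int]_n) : vgt (a - b) c <-> vgt a (b + c).
  rewrite [vgt (a - b) c]vgtP [vgt a _]vgtP opprD addrA.
  by split=> -[? [i lt_i]]; split=> //; exists i; move: lt_i; entrywise.
elim: us x => [|v vs IH] x /=; first by split.
rewrite IH; split=> [[xv down] [|i] lt_i|down].
- by rewrite big_geq // add0r.
- by rewrite big_nat_recl // -addrA; apply/vgtB/down.
- split=> [|i lt_i]; first by have := down 0%N isT; rewrite big_geq // add0r.
  by apply/vgtB; have := down i.+1 lt_i; rewrite big_nat_recl // -addrA.
Qed.

End Vectors.

(** * Markov bases *)

Section Lattice.
Variables (m n : nat) (A : 'M[nat]_(m, n)).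
Implicit Types (u v w x y g : 'cV[int]_n) (M : {fset 'cV[int]_n}).

Lemma kerZ0 : kerZ A 0.
Proof. exact: mulmx0. Qed.

Lemma kerZD u v : kerZ A u -> kerZ A v -> kerZ A (u + v).
Proof. by rewrite /kerZ mulmxDr => -> ->; rewrite addr0. Qed.

Lemma kerZN u : kerZ A u -> kerZ A (- u).
Proof. by rewrite /kerZ mulmxN => ->; rewrite oppr0. Qed.

Lemma kerZ_trans y x z : kerZ A (x - y) -> kerZ A (y - z) -> kerZ A (x - z).
Proof. by move=> xy yz; rewrite -(subrKA y); apply: kerZD. Qed.

Lemma kerZ_sym x y : kerZ A (x - y) -> kerZ A (y - x).
Proof. by move=> /kerZN; rewrite opprB. Qed.

Lemma walk_kerZ M x y :
  (forall v, v \in M -> kerZ A v) -> walk M x y -> kerZ A (x - y).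
Proof.
move=> MA; elim=> [a b [_ _ [/MA|/MA/kerZN]]|a|a b c _ ab _ bc].
- by [].
- by rewrite opprB.
- by rewrite subrr; apply: kerZ0.
- exact: kerZ_trans ab bc.
Qed.

Lemma markov_basisP M :
  markov_basis A M <-> (forall v, v \in M -> kerZ A v) /\
    (forall x y, nonneg x -> nonneg y -> kerZ A (x - y) -> walk M x y).
Proof.
split=> -[MA HM]; split=> // x y x0 y0 /(HM _ _ x0 y0).
  case=> vs [vsM xy prefix].
  elim: vs x x0 xy prefix vsM {HM} => [|v vs IH] x x0 xy prefix vsM.
    by move/eqP: xy; rewrite big_nil subr_eq0 => /eqP->; apply: rt_refl.
  have xv0 : nonneg (x - v).
    by have := prefix 1%N isT; rewrite /= take0 big_seq1.
  apply: (@rt_trans _ _ _ (x - v)).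
    apply: rt_step; split=> //; rewrite subKr addrC addrA addNr sub0r.
    by apply: vsM; rewrite inE eqxx.
  apply: IH => // [|p /andP[p1 ps]|w wvs].
  - by rewrite addrAC xy big_cons addrC addKr.
  - by have := prefix p.+1 ps; rewrite /= big_cons opprD addrA.
  - by apply: vsM; rewrite inE wvs orbT.
move/clos_rt_rt1n_iff; elim=> [a|a b c [a0 b0 ab] _ [vs [vsM bc prefix]]].
  by exists [::]; split=> [//||[|p]//]; rewrite big_nil subrr.
exists ((a - b) :: vs); split=> [v||[|p] //= ps].
- by rewrite inE => /orP[/eqP->|/vsM //]; rewrite opprB.
- by rewrite big_cons -bc subrKA.
rewrite big_cons opprD addrA subKr.
case: p ps => [|p] ps; last exact: prefix.
by rewrite take0 big_nil subr0.
Qed.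

(** Dickson's lemma, applied to the pairs of distinct points of a common fiber,
gives finitely many pairs (a, b) such that every pair (x, y) dominates one of
them; the differences a - b form a Markov basis. Indeed x moves by b - a to
x - a + b, which has the part b in common with y; what remains is the pair
(x - a, y - b), whose coordinate sum is smaller. *)
Lemma markov_basis_exists : exists M, markov_basis A M.
Proof.
pose P (p : 'cV[int]_n * 'cV[int]_n) :=
  [/\ nonneg p.1, nonneg p.2, kerZ A (p.1 - p.2) & p.1 <> p.2].
pose f (p : 'cV[int]_n * 'cV[int]_n) (i : 'I_n + 'I_n) :=
  match i with inl j => absz (p.1 j 0) | inr j => absz (p.2 j 0) end.
have [s [sP sdom]] := dickson f (enum {: 'I_n + 'I_n}) P.
exists [fset p.1 - p.2 | p in s]%fset; apply/markov_basisP; split=> [v|].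
  by move/imfsetP=> [p /= /sP[_ _ pA _] ->].
move=> x y.
have [k] := ubnP (\sum_i f (x, y) i); elim: k x y => // k IH x y lt_k x0 y0 xyA.
have [<-|/eqP neq_xy] := eqVneq x y; first exact: rt_refl.
have [[a b] abs dom] := sdom (x, y) (And4 x0 y0 xyA neq_xy).
have [/= a0 b0 abA neq_ab] := sP _ abs.
have ax : nonneg (x - a).
  move=> i; have := dom (inl i); rewrite mem_enum => /(_ isT) /=.
  by move: (a0 i) (x0 i); entrywise.
have yb : nonneg (y - b).
  move=> i; have := dom (inr i); rewrite mem_enum => /(_ isT) /=.
  by move: (b0 i) (y0 i); entrywise.
apply: (@rt_trans _ _ _ (x - a + b)); last first.
  rewrite -[X in clos_refl_trans _ _ _ X](subrK b).
  apply: walkD => //; apply: IH => //; last first.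
    have -> : x - a - (y - b) = x - y + - (a - b).
      by apply/colP=> i; entrywise.
    by apply: kerZD => //; apply: kerZN.
  rewrite -ltnS; apply: leq_ltn_trans lt_k.
  pose z := (x - a, y - b).
  have [i lt_i] : exists i : ('I_n + 'I_n)%type, (f z i < f (x, y) i)%N.
    apply: NNPP => nlt; apply: neq_ab; apply/colP=> i.
    have nl : ~ (f z (inl i) < f (x, y) (inl i))%N.
      by move=> lt; apply: nlt; exists (inl i).
    have nr : ~ (f z (inr i) < f (x, y) (inr i))%N.
      by move=> lt; apply: nlt; exists (inr i).
    move: nl nr (a0 i) (b0 i) (ax i) (yb i).
    by rewrite /f /z /=; entrywise.
  rewrite (bigD1 i) //= [leqRHS](bigD1 i) //= -addSn leq_add //.
  apply: leq_sum => -[j|j] _; rewrite /f /z /=.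
    by move: (a0 j) (ax j); entrywise.
  by move: (b0 j) (yb j); entrywise.
apply: rt_step; split=> // [i|].
  by rewrite mxE addr_ge0.
left; apply/imfsetP; exists (a, b) => //=.
by apply/colP=> i; entrywise.
Qed.

Lemma markov_basis_replace M M' :
    markov_basis A M -> (forall v, v \in M' -> kerZ A v) ->
    (forall v, v \in M -> walk M' (pos_part v) (neg_part v)) ->
  markov_basis A M'.
Proof.
move=> /markov_basisP[_ HM] M'A MM'.
apply/markov_basisP; split=> // x y x0 y0 xyA.
by apply: walk_moves MM' _; apply: HM.
Qed.

(** * Linked points and strongly semiconformal decompositions *)

Definition link x y : Prop :=
  [/\ nonneg x, nonneg y, kerZ A (x - y) & exists i, 0 < x i 0 /\ 0 < y i 0].

Definition linked := clos_refl_trans _ link.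

Lemma link_sym x y : link x y -> link y x.
Proof.
by case=> x0 y0 xyA [i [xi yi]]; split=> //; [apply: kerZ_sym|exists i].
Qed.

Lemma linked_sym x y : linked x y -> linked y x.
Proof. by apply: rt_sym; apply: link_sym. Qed.

(** Steps from a point to itself are dropped from the chain, so that the summands
are nonzero. *)
Lemma linked_walk_down x y : nonneg x ->
  linked x y <-> exists us : seq 'cV[int]_n,
    [/\ forall v, v \in us -> kerZ A v /\ v <> 0, x - y = \sum_(v <- us) v &
        walk_down x us].
Proof.
move=> x0; split=> [/clos_rt_rt1n_iff|].
  elim=> {x y x0} [x|x z y [x0 z0 xzA xz] _ [us [usA zy down]]].
    by exists [::]; split; rewrite ?big_nil ?subrr.
  have [->|/eqP neq] := eqVneq x z; first by exists us.
  exists ((x - z) :: us); split=> [v||/=].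
  - rewrite inE => /orP[/eqP->|/usA //]; split=> //.
    by move/eqP; rewrite subr_eq0 => /eqP.
  - by rewrite big_cons -zy subrKA.
  - by rewrite subKr; split=> //; apply/sharesP.
case=> us [usA xy down].
elim: us x x0 xy usA down => [|v us IH] x x0 xy usA /=.
  by move/eqP: xy; rewrite big_nil subr_eq0 => /eqP-> _; apply: rt_refl.
case=> xv down.
have xv0 : nonneg (x - v).
  by move/vgtP: xv => [ge _] i; move: (ge i); entrywise.
have [vA _] : kerZ A v /\ v <> 0 by apply: usA; rewrite inE eqxx.
apply: (@rt_trans _ _ _ (x - v)).
  by apply: rt_step; split; rewrite ?subKr //; apply/sharesP; rewrite ?subKr.
apply: IH => // [|w wus]; last by apply: usA; rewrite inE wus orbT.
by rewrite addrAC xy big_cons addrC addKr.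
Qed.

(** A chain from u^+ to u^- has automatically at least two summands when u is
nonzero, since a single one would give u^+ > u^+; and for u = 0 the points u^+
and u^- coincide, hence are linked. *)
Lemma ssc_linked u : kerZ A u ->
  [/\ kerZ A u, u <> 0 & ~ exists us, proper_ssc_decomposition A u us] <->
  ~ linked (pos_part u) (neg_part u).
Proof.
move=> uA; have p0 := @pos_part_nonneg _ u.
split=> [[_ u0 nssc]|nlink].
  move/(linked_walk_down _ p0)=> [us [usA]]; rewrite pos_partB => us_sum down.
  apply: nssc; exists us; split; last by move=> v /usA[].
  have dn := (walk_downP _ _).1 down.
  have size2 : (2 <= size us)%N.
    case: us us_sum {usA dn} down => [|v [|? ?]] //= u_sum.
      by case: u0; rewrite u_sum big_nil.
    by rewrite u_sum big_seq1 => -[[_ neq] _]; case: neq.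
  split=> // [|| i /andP[_ lt_i]].
  - by split=> // v /usA[].
  - by have := dn 0%N (ltnW size2); rewrite big_geq // add0r.
  - exact: dn.
split=> // [u0|[us [[size2 [_ usA] us_sum first_gt next_gt] us0]]].
  by apply: nlink; rewrite u0 -[in pos_part 0]oppr0 pos_partN; apply: rt_refl.
apply: nlink; apply/(linked_walk_down _ p0); exists us.
rewrite pos_partB; split=> //.
  by move=> v v_us; split; [apply: usA|apply: us0].
apply/walk_downP=> -[|i] lt_i; last exact: next_gt.
by rewrite big_geq // add0r.
Qed.

(** * Walks that avoid a given move *)

Hypothesis pointed : forall u, kerZ A u /\ nonneg u <-> u = 0.

Lemma fiber_antichain x y :
  nonneg (x - y) -> kerZ A (x - y) -> x = y.
Proof. by move=> ge xyA; apply/eqP; rewrite -subr_eq0; apply/eqP/pointed. Qed.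

(** If v were used at a point a of the walk, then a >= v^+, and a + g would be a
point of the fiber of v^+ strictly above v^+; a step by -v is a step by v read
backwards. *)
Lemma walk_avoid M v x y g i :
    (forall t, t \in M -> kerZ A t) -> kerZ A v -> nonneg g -> 0 < g i 0 ->
    kerZ A (x + g - pos_part v) ->
  walk M x y -> walk (M `\` [fset v; - v])%fset x y.
Proof.
move=> MA vA g0 gi xvA /clos_rt_rt1n_iff xy.
elim: xy xvA => {x y} [x|x y z xy _ IH] xvA.
  exact: rt_refl.
have yx : kerZ A (y - x).
  by apply: kerZ_sym; apply: (walk_kerZ MA); apply: rt_step.
have yvA : kerZ A (y + g - pos_part v).
  apply: kerZ_trans xvA.
  by have -> : y + g - (x + g) = y - x by apply/colP=> j; entrywise.
have [x0 y0 xyM] := xy.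
have not_v a b : nonneg a -> nonneg b -> kerZ A (a + g - pos_part v) ->
    a - b <> v.
  move=> a0 b0 aA ab.
  have gea := pos_part_vge a0 b0; rewrite ab in gea.
  have ag : a + g = pos_part v.
    by apply: fiber_antichain aA => j; move: (gea j) (g0 j); entrywise.
  by move: (gea i) gi; rewrite -ag; entrywise.
apply: rt_trans (IH yvA); apply/rt_step/step_avoid => //; exact: not_v.
Qed.

(** Consecutive points of the chain contain a common unit vector e; they are
connected by translating by e a walk in the fiber below. *)
Lemma linked_walk M v x y :
    markov_basis A M -> kerZ A v -> linked x y -> kerZ A (x - pos_part v) ->
  walk (M `\` [fset v; - v])%fset x y.
Proof.
move=> /markov_basisP[MA HM] vA /clos_rt_rt1n_iff xy.
elim: xy => {x y} [x|x z y [x0 z0 xzA [i [xi zi]]] _ IH] xvA.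
  exact: rt_refl.
apply: rt_trans (IH _); last exact: kerZ_trans (kerZ_sym xzA) xvA.
pose e : 'cV[int]_n := delta_mx i 0.
have e0 : nonneg e by move=> j; entrywise.
have ei : 0 < e i 0 by rewrite mxE !eqxx.
have subn0 w : nonneg w -> 0 < w i 0 -> nonneg (w - e).
  move=> w0 wi j; move: (w0 j); rewrite !mxE eqxx andbT.
  by case: eqP => [->|_] /=; move: wi; entrywise.
rewrite -[x](subrK e) -[z](subrK e); apply: walkD => //.
apply: (walk_avoid MA vA e0 ei); first by rewrite subrK.
apply: HM; [exact: subn0|exact: subn0|].
by rewrite opprB addrA subrK.
Qed.

(** * Moves of minimal Markov bases *)

Lemma minimal_not_linked M u :
    minimal_markov_basis A M -> u \in M \/ - u \in M ->
  ~ linked (pos_part u) (neg_part u).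
Proof.
move=> [HM minM] uM u_linked.
have [MA _] := HM.
have uA : kerZ A u by case: uM => [/MA //|/MA/kerZN]; rewrite opprK.
have uwalk : walk (M `\` [fset u; - u])%fset (pos_part u) (neg_part u).
  by apply: linked_walk => //; rewrite subrr; apply: kerZ0.
apply: (minM _ (fproper_remove uM)).
apply: (markov_basis_replace HM) => v.
  by rewrite in_fsetD => /andP[_ /MA].
move=> vM.
have [->|vu] := eqVneq v u; first exact: uwalk.
have [->|vNu] := eqVneq v (- u).
  by rewrite pos_partN neg_partN; apply: walk_sym.
by apply: move_walk; left; rewrite in_fsetD in_fset2 (negPf vu) (negPf vNu).
Qed.

(** The move v is the one by which a walk from u^+ to u^- leaves the component of
u^+ for the last time; its ends v^+ and v^- are still connected after the
exchange, by way of u^+ and u^-. *)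
Lemma markov_basis_exchange M u :
    markov_basis A M -> kerZ A u -> ~ linked (pos_part u) (neg_part u) ->
  exists2 v, v \in M \/ - v \in M &
    markov_basis A (u |` (M `\` [fset v; - v]))%fset.
Proof.
move=> HM uA nlink; have [MA Mwalk] := (markov_basisP _).1 HM.
have : walk M (pos_part u) (neg_part u).
  apply: Mwalk; rewrite ?pos_partB //.
    exact: pos_part_nonneg.
  exact: neg_part_nonneg.
move/(@last_exit _ _ (linked (pos_part u))).
move=> /(_ nlink (rt_refl _ _ _))[x [y [ux nuy xy]]].
have [x0 y0 xyM] := xy.
have xyA : kerZ A (x - y) by case: xyM => [/MA //|/MA/kerZN]; rewrite opprB.
(* x and y are unlinked, which forces x = v^+ and y = v^- for v = x - y. *)
have disj i : x i 0 = 0 \/ y i 0 = 0.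
  case: (x i 0 =P 0) => [|xi]; first by left.
  case: (y i 0 =P 0) => [|yi]; first by right.
  case: nuy; apply: rt_trans ux _; apply: rt_step; split=> //; exists i.
  by split; rewrite lt_neqAle eq_sym; apply/andP; split=> //; apply/eqP.
set v := x - y.
have [xv yv] : x = pos_part v /\ y = neg_part v by apply/pos_neg_partP.
move=> yu_walk; exists v; first by rewrite opprB.
have M'A t : t \in (u |` (M `\` [fset v; - v]))%fset -> kerZ A t.
  by rewrite in_fset1U in_fsetD => /orP[/eqP->|/andP[_ /MA]].
apply: (markov_basis_replace HM) => //.
have subM' a b : walk (M `\` [fset v; - v])%fset a b ->
    walk (u |` (M `\` [fset v; - v]))%fset a b.
  apply: rt_sub => c d [c0 d0 cd]; apply: rt_step; split=> //.
  by case: cd => cd; [left|right]; rewrite in_fset1U cd orbT.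
have vwalk : walk (u |` (M `\` [fset v; - v]))%fset (pos_part v) (neg_part v).
  rewrite -xv -yv.
  apply: (@rt_trans _ _ _ (pos_part u)).
    apply/subM'/linked_walk => //; first exact: linked_sym ux.
    by rewrite -xv subrr; apply: kerZ0.
  apply: (@rt_trans _ _ _ (neg_part u)).
    by apply: move_walk; left; rewrite in_fset1U eqxx.
  apply/subM'/walk_sym.
  (* The walk from y stays in the fiber of x = v^+ but outside its component,
     so it never passes through x, the only point where v applies and the
     only one that -v leads to. *)
  have : kerZ A (x - y) by [].
  move/clos_rt_rt1n_iff: yu_walk.
  elim=> [a _|a b c [[a0 b0 abM] na nb] _ IH xaA]; first exact: rt_refl.
  have abA : kerZ A (a - b) by case: abM => [/MA //|/MA/kerZN]; rewrite opprB.
  have xbA := kerZ_trans xaA abA.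
  have not_v p q : nonneg p -> nonneg q -> kerZ A (x - p) ->
      ~ linked (pos_part u) p -> p - q <> v.
    move=> p0 q0 xpA np pq; apply: np.
    suff -> : p = x by [].
    apply: fiber_antichain; last exact: kerZ_sym.
    by rewrite xv -pq; apply: pos_part_vge.
  apply: rt_trans (IH xbA); apply: rt_step; apply: step_avoid => //.
    exact: not_v xaA na.
  exact: not_v xbA nb.
move=> t tM.
have [->|tv] := eqVneq t v; first exact: vwalk.
have [->|tNv] := eqVneq t (- v).
  by rewrite pos_partN neg_partN; apply: walk_sym.
apply: move_walk; left.
by rewrite in_fset1U in_fsetD in_fset2 (negPf tv) (negPf tNv) tM orbT.
Qed.

(** Minimality is imposed on the cardinality of the set added to u, so that u
itself cannot be discarded. *)
Lemma in_minimal_markov_basis u :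
    kerZ A u -> ~ linked (pos_part u) (neg_part u) ->
  exists2 M, minimal_markov_basis A M & u \in M.
Proof.
move=> uA nlink.
have [S [HS minS]] : exists S, markov_basis A (u |` S)%fset /\
    forall S', markov_basis A (u |` S')%fset -> (#|` S| <= #|` S'|)%N.
  have [M HM] := markov_basis_exists.
  have : markov_basis A (u |` M)%fset.
    apply: (markov_basis_replace HM) => v.
      by rewrite in_fset1U => /orP[/eqP->|/(proj1 HM)].
    by move=> vM; apply: move_walk; left; rewrite in_fset1U vM orbT.
  have [k] := ubnP #|` M|; elim: k M {HM} => // k IH M lt_k HM.
  have [[M' [HM' lt_M]]|nM] := classic (exists M',
      markov_basis A (u |` M')%fset /\ (#|` M'| < #|` M|)%N).
    by apply: (IH M') => //; apply: leq_trans lt_M _.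
  exists M; split=> // M' HM'; rewrite leqNgt; apply/negP=> lt_M.
  by apply: nM; exists M'.
exists (u |` S)%fset; last by rewrite in_fset1U eqxx.
split=> // T ltT HT.
have [uT|nuT] := boolP (u \in T).
  have := minS (T `\ u)%fset; rewrite fsetD1K // => /(_ HT).
  have := fproper_ltn_card ltT.
  by rewrite (cardfsD1 u T) uT cardfsU1; case: (u \notin S); lia.
have [v vT HT'] := markov_basis_exchange HT uA nlink.
have leTS : (#|` T| <= #|` S|)%N.
  apply/fsubset_leq_card/fsubsetP=> t tT.
  have := fsubsetP (fproper_sub ltT) t tT.
  by rewrite in_fset1U => /orP[/eqP tu|//]; rewrite tu (negPf nuT) in tT.
have := leq_trans (fproper_ltn_card (fproper_remove vT)) leTS.
by rewrite ltnNge minS.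
Qed.

End Lattice.

Theorem proposition1p4 (m n : nat) (A : 'M[nat]_(m, n))
    (hA : forall u : 'cV[int]_n, kerZ A u /\ nonneg u <-> u = 0) :
  forall u : 'cV[int]_n,
    universal_markov_basis A u <->
    [/\ kerZ A u, u <> 0 &
        ~ exists us : seq 'cV[int]_n, proper_ssc_decomposition A u us].
Proof.
move=> u; split=> [[M [minM uM]]|irr].
  have uA : kerZ A u.
    by have [[MA _] _] := minM; case: uM => /MA // /kerZN; rewrite opprK.
  by apply/(ssc_linked uA)/(minimal_not_linked hA minM).
have [uA _ _] := irr.
have [M minM uM] := in_minimal_markov_basis hA uA ((ssc_linked uA).1 irr).
by exists M; split=> //; left.
Qed.
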